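(* For every odd integer $n=2m+1\geq7$, \[ D_3(n)\geq\left\lfloor\frac{m-1}{2}\right\rfloor=\left\lfloor\frac{n-3}{4}\right\rfloor. \] Consequently, \[ C_3(n)\geq\left\lfloor\frac{n-3}{4}\right\rfloor. \]
   Context: For an integer $n\geq3$, let \[ \mathcal{T}_n=\left\{\frac{n!}{e_1!\,e_2!\,e_3!}: e_1+e_2+e_3=n,\ e_i\geq0\text{ integers}\right\} \] as a set (repeated values removed) of trinomial coefficient values. For an integer $t$, let $r(t)=\#\{(x,y):x,y\in\mathcal{T}_n,\ x\leq y,\ x+y=t\}$. Define $C_3(n)=\sum_t\max(r(t)-1,0)$ and $D_3(n)=\#\{t:r(t)\geq2\}$. *)

(* Defs.v *)
From mathcomp Require Import all_boot all_order all_algebra finmap.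
From mathcomp Require Import all_classical.

Set Implicit Arguments.
Unset Strict Implicit.
Unset Printing Implicit Defensive.

Local Open Scope classical_set_scope.
Local Open Scope nat_scope.

(* The division is exact. *)
Definition trinomial (e1 e2 e3 : nat) : nat :=
  (e1 + e2 + e3)`! %/ (e1`! * e2`! * e3`!).

Definition trinomials (n : nat) : set nat :=
  [set x | exists e1 e2 e3, e1 + e2 + e3 = n /\ x = trinomial e1 e2 e3].

Definition reps (n : nat) (t : int) : set (nat * nat) :=
  [set p | [/\ trinomials n p.1, trinomials n p.2, p.1 <= p.2
             & Posz (p.1 + p.2) = t]].

(* [fset_set A] and [\sum_(t \in A) F t] are only meaningful when the set,
   respectively the support of F, is finite; see the lemmas below. *)
Definition r (n : nat) (t : int) : nat := #|` fset_set (reps n t)|.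

(* Truncated subtraction: r n t - 1 is max(r(t) - 1, 0). *)
Definition C3 (n : nat) : nat :=
  \big[addn/0]_(t \in [set: int]) (r n t - 1).

Definition D3 (n : nat) : nat :=
  #|` fset_set [set t : int | 2 <= r n t]|.

Lemma trinomial_exact e1 e2 e3 :
  trinomial e1 e2 e3 * (e1`! * e2`! * e3`!) = (e1 + e2 + e3)`!.
Proof.
rewrite /trinomial divnK //.
have fD a b : a`! * b`! %| (a + b)`!.
  by rewrite -(@bin_fact (a + b) a) ?leq_addr // addKn dvdn_mull.
by apply: dvdn_trans (fD _ _); apply: dvdn_mul (fD _ _) _.
Qed.

Lemma finite_trinomials n : finite_set (trinomials n).
Proof.
apply: (@sub_finite_set _ _ `I_(n`!.+1)) => [x|]; last exact: finite_II.
move=> [e1 [e2 [e3 [<- ->]]]] /=; rewrite ltnS; exact: leq_div.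
Qed.

Lemma finite_reps n t : finite_set (reps n t).
Proof.
apply: (@sub_finite_set _ _ (trinomials n `*` trinomials n)).
  by move=> p [].
by apply: finite_setX; exact: finite_trinomials.
Qed.

Lemma finite_r_gt0 n : finite_set [set t : int | 0 < r n t].
Proof.
apply: (@sub_finite_set _ _ ((fun p : nat * nat => Posz (p.1 + p.2)) @`
    (trinomials n `*` trinomials n))).
  move=> t /=; rewrite /r cardfs_gt0 => /fset0Pn[p].
  rewrite in_fset_set; last exact: finite_reps.
  by rewrite inE => -[p1 p2 _ <-]; exists p.
by apply: finite_image; apply: finite_setX; exact: finite_trinomials.
Qed.

Lemma finite_D3 n : finite_set [set t : int | 2 <= r n t].
Proof. by apply: sub_finite_set (finite_r_gt0 n) => t /ltnW. Qed.

Lemma finite_C3 n :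
  finite_set ([set: int] `&` (fun t => r n t - 1) @^-1` [set~ 0]).
Proof.
apply: sub_finite_set (finite_r_gt0 n) => t [_ /= +].
by case: (r n t).
Qed.

(* Main.v *)
Require Import Defs.
From mathcomp Require Import all_boot.
From mathcomp Require Import all_algebra finmap all_classical zify ring.

(** With i + j + 2 = m one has
      (i, j+2, m+1) + (i+2, j+1, m) = (i+1, j+2, m) + (i+2, j, m+1),
    writing (a, b, c) for n!/(a! b! c!): after division by
    n!/((i+2)! (j+2)! (m+1)!) this is the identity
      (i+1)(i+2) + (j+2)(m+1) = (i+2)(m+1) + (j+2)(j+1).
    For i < j the first summand is smaller than both summands on the right, so
    the two representations differ, and both summands on the left increase
    with i.  The admissible i are those with 2i + 3 <= m. *)

(** With n = a + b + c + 1, both sides are n!/(a! b! c!). *)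
Lemma trinomial_shift a b c :
  trinomial a.+1 b c * a.+1 = trinomial a b.+1 c * b.+1.
Proof.
apply/eqP; rewrite -(eqn_pmul2r (_ : 0 < a`! * b`! * c`!)) ?muln_gt0 ?fact_gt0 //.
have E : trinomial a.+1 b c * (a.+1`! * b`! * c`!) =
         trinomial a b.+1 c * (a`! * b.+1`! * c`!).
  by rewrite !trinomial_exact addnS.
by apply/eqP; move: E; rewrite !factS; nia.
Qed.

Lemma trinomialC23 a b c : trinomial a b c = trinomial a c b.
Proof. by rewrite /trinomial addnAC mulnAC. Qed.

Lemma trinomialC12 a b c : trinomial a b c = trinomial b a c.
Proof. by rewrite /trinomial (addnC a) (mulnC a`!). Qed.

Lemma trinomial_gt0 a b c : 0 < trinomial a b c.
Proof.
by have := fact_gt0 (a + b + c); rewrite -trinomial_exact muln_gt0 => /andP[].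
Qed.

Lemma trinomial_shift_lt a b c :
  a < b -> trinomial a b.+1 c < trinomial a.+1 b c.
Proof.
move=> ab; have := trinomial_shift a b c; have := trinomial_gt0 a b.+1 c; nia.
Qed.

Lemma trinomial_shift_le a b c :
  a <= b -> trinomial a b.+1 c <= trinomial a.+1 b c.
Proof. by move=> ab; have := trinomial_shift a b c; nia. Qed.

Lemma trinomialsP n a b c : a + b + c = n -> trinomials n (trinomial a b c).
Proof. by move=> <-; exists a, b, c. Qed.

Section Collision.
Variables i j : nat.
Let m := i + j + 2.

Let x1 := trinomial i j.+2 m.+1.
Let y1 := trinomial i.+2 j.+1 m.
Let x2 := trinomial i.+2 j m.+1.
Let y2 := trinomial i.+1 j.+2 m.

(** Along the chain [x1], [y2], [y1], [x2] each step moves one unit between two lower indices, so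
    [trinomial_shift] gives every ratio. *)
Let y2E : y2 * i.+1 = x1 * m.+1.
Proof. by rewrite /y2 /x1 trinomialC23 trinomial_shift trinomialC23. Qed.

Let y1E : y1 * i.+2 = y2 * j.+2.
Proof. exact: trinomial_shift. Qed.

Let x2E : x2 * m.+1 = y1 * j.+1.
Proof.
rewrite /x2 /y1 trinomialC12 trinomialC23 (trinomialC12 j) trinomial_shift.
by rewrite trinomialC12 trinomialC23 (trinomialC12 j.+1).
Qed.

Lemma trinomial_collision : x1 + y1 = y2 + x2.
Proof.
(* This factor turns all four terms into multiples of [y2]. *)
apply/eqP; rewrite -(eqn_pmul2r (_ : 0 < i.+2 * m.+1)) ?muln_gt0 //; apply/eqP.
have -> : (x1 + y1) * (i.+2 * m.+1) = x1 * m.+1 * i.+2 + y1 * i.+2 * m.+1 by ring.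
have -> : (y2 + x2) * (i.+2 * m.+1) = y2 * i.+2 * m.+1 + x2 * m.+1 * i.+2 by ring.
rewrite x2E (mulnAC y1 j.+1) -y2E y1E /m; ring.
Qed.

Lemma trinomial_collision_r : i < j ->
  1 < r (2 * m + 1) (Posz (x1 + y1)).
Proof.
move=> ij.
have x1y2 : x1 < y2.
  rewrite /x1 /y2 (trinomialC23 i) (trinomialC23 i.+1).
  by apply: trinomial_shift_lt; rewrite /m; lia.
have x1x2 : x1 < x2.
  (* Passes through (i+1, j+1, m+1); the second shift is an equality when j = i + 1. *)
  by apply: leq_trans (trinomial_shift_lt _ _ _ _) (trinomial_shift_le _ _ _ _); lia.
have sumE := trinomial_collision.
have x1T : trinomials (2 * m + 1) x1 by apply: trinomialsP; rewrite /m; lia.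
have y1T : trinomials (2 * m + 1) y1 by apply: trinomialsP; rewrite /m; lia.
have x2T : trinomials (2 * m + 1) x2 by apply: trinomialsP; rewrite /m; lia.
have y2T : trinomials (2 * m + 1) y2 by apply: trinomialsP; rewrite /m; lia.
(* [reps] wants ordered pairs: [x1] lies below both [x2] and [y2], hence [y1] above both, while the
   order of [x2] and [y2] is left open. *)
pose p := (x1, y1); pose q := (minn x2 y2, maxn x2 y2).
have pq : p != q by rewrite xpair_eqE /=; lia.
apply: (@leq_trans #|` [fset p; q]%fset|); first by rewrite cardfs2 pq.
apply: fsubset_leq_card; apply/fsubsetP => z.
rewrite in_fset_set; last exact: finite_reps.
rewrite !inE => /orP[]/eqP->; split=> //=; by [lia | case: leqP].
Qed.

End Collision.

(** Each t with [2 <= r n t] contributes at least 1 to the sum. *)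
Lemma leq_D3_C3 n : D3 n <= C3 n.
Proof.
have finC := finite_C3 n; rewrite /C3.
set s := finite_support _ _ _.
have sE t : t \in s -> 1 <= r n t - 1.
  by rewrite in_finite_support // inE /= => -[_]; case: (r n t - 1).
apply: (@leq_trans (size s)).
  apply: uniq_leq_size; first exact: fset_uniq.
  move=> t; rewrite in_fset_set ?inE /=; last exact: finite_D3.
  by rewrite in_finite_support // inE /= => rt; split=> //; lia.
by rewrite -sum1_size big_seq [leqRHS]big_seq; apply: leq_sum => t /sE.
Qed.

Theorem theorem13p3 (n m : nat) (hn : n = 2 * m + 1) (hn7 : 7 <= n) :
  [/\ (m - 1) %/ 2 = (n - 3) %/ 4,
      D3 n >= (m - 1) %/ 2
    & C3 n >= (n - 3) %/ 4].
Proof.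
have floorE : (m - 1) %/ 2 = (n - 3) %/ 4 by lia.
suff D3_ge : (m - 1) %/ 2 <= D3 n.
  by split=> //; rewrite -floorE (leq_trans D3_ge) ?leq_D3_C3.
(* This is [x1 + y1] for j = m - i - 2. *)
pose t i := trinomial i (m - i) m.+1 + trinomial i.+2 (m - i.+1) m.
have t_incr i k : i < k -> 2 * k + 3 <= m -> t i < t k.
  elim: k => // k IHk; rewrite ltnS leq_eqVlt => /orP ik km.
  have tk : t k < t k.+1.
    rewrite /t; have -> : m - k = (m - k.+1).+1 by lia.
    have -> : m - k.+1 = (m - k.+2).+1 by lia.
    rewrite -addSn; apply: leq_add; last apply: ltnW.
      by apply: trinomial_shift_lt; lia.
    by apply: trinomial_shift_lt; lia.
  case: ik => [/eqP-> //|ik]; apply: ltn_trans (IHk ik _) tk; lia.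
(* [i < K] is equivalent to 2i + 3 <= m, that is, to i < j. *)
pose K := (m - 1) %/ 2.
have t_inj : {in iota 0 K &, injective (Posz \o t)}.
  move=> i k; rewrite !mem_iota /K => iK kK [tik].
  case: (ltngtP i k) => // ik; have := t_incr _ _ ik; lia.
rewrite -/K -(size_iota 0 K) -(size_map (Posz \o t)) /D3.
apply: uniq_leq_size; first by rewrite map_inj_in_uniq ?iota_uniq.
move=> _ /mapP[i iK ->].
rewrite in_fset_set; last exact: finite_D3.
rewrite inE /= /t; move: iK; rewrite mem_iota /K => iK.
have := @trinomial_collision_r i (m - i - 2).
have -> : i + (m - i - 2) + 2 = m by lia.
have -> : (m - i - 2).+2 = m - i by lia.
have -> : (m - i - 2).+1 = m - i.+1 by lia.
by rewrite hn; apply; lia.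
Qed.
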